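(* Let $Q=T[H_1,\dots,H_t]$ be an acyclic composition, i.e. the composition of a digraph $T$ with vertex set $\{u_1,\dots,u_t\}$ that contains no directed cycle and digraphs $H_1,\dots,H_t$. If for every $i\in[t]$ the digraph $H_i$ satisfies property BNY, then $Q$ satisfies property BNY.
   Context: Digraphs are finite, without loops and without parallel arcs (a pair of opposite arcs $xy,yx$ is allowed). All paths and cycles are directed, and a single vertex is a path of order 1. Write $[t]=\{1,\dots,t\}$. The order of a digraph is its number of vertices; $V(D)$ and $A(D)$ denote the vertex set and arc set of $D$. Partition: a partition of a digraph $D$ is a pair $(A,B)$ of vertex-disjoint induced subdigraphs of $D$ with $V(A)\cup V(B)=V(D)$. Path parameters: $\lambda(D)$ is the maximum order of a path in $D$. A $k$-path subdigraph of $D$ is a collection of $k$ vertex-disjoint paths in $D$; its order is the total number of vertices on these paths. $\lambda_k(D)$ is the maximum order of a $k$-path subdigraph of $D$; thus $\lambda(D)=\lambda_1(D)$. Property BNY: a digraph $D$ satisfies BNY if for every integer $q$ with $1\le q\le\lambda(D)-1$ there is a partition $(A,B)$ of $D$ such that $\lambda(A)\le q$ and, for all $k\in\{1,2,\dots,|V(B)|\}$, $\lambda_k(B)\le\lambda_k(D)-q$. Composition: let $T$ be a digraph with vertex set $\{u_1,\dots,u_t\}$ and, for $i\in[t]$, let $H_i$ be a (nonempty) digraph with vertex set $\{u_{i,j_i}: j_i\in[n_i]\}$. The composition $Q=T[H_1,\dots,H_t]$ is the digraph with vertex set $\{u_{i,j_i}: i\in[t],\, j_i\in[n_i]\}$ and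 arc set $A(Q)=\bigcup_{i=1}^t A(H_i)\cup\{u_{i,j_i}u_{p,q_p}: u_iu_p\in A(T),\ j_i\in[n_i],\ q_p\in[n_p]\}$. The composition is called acyclic if $T$ is acyclic (contains no directed cycle; in particular no pair of opposite arcs). *)

(* Defs.v *)
From mathcomp Require Import all_boot.

Set Implicit Arguments.
Unset Strict Implicit.
Unset Printing Implicit Defensive.

(* Since [arc] is a relation there are no parallel arcs; [arc x y && arc y x]
   is allowed. *)
Record digraph := Digraph {
  vertex :> finType;
  arc : rel vertex;
  arc_irrefl : irreflexive arc
}.

Arguments arc {d}.

(* A path or cycle is given by its sequence of vertices, so that its order is
   the size of the sequence. *)
Definition dipath (D : digraph) (p : seq D) : bool :=
  [&& p != [::], sorted arc p & uniq p].

Definition dicycle (D : digraph) (c : seq D) : bool :=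
  [&& 1 < size c, cycle arc c & uniq c].

Definition acyclic (D : digraph) : Prop :=
  ~ exists c : seq D, dicycle c.

Definition path_subdigraph (D : digraph) (P : seq (seq D)) : bool :=
  all (@dipath D) P && uniq (flatten P).

(* A path has at most #|D| vertices, so the bounded sequences below, which make
   the range of the maximum a finite type, miss no path. *)
Definition lambda (D : digraph) : nat :=
  \max_(p : {bseq #|D| of D} | dipath p) size p.

(* The paths must be nonempty, so for k > #|D| the range is empty and the
   value is 0; for k <= #|D| the range contains k single vertices. *)
Definition lambda_k (D : digraph) (k : nat) : nat :=
  \max_(P : k.-tuple {bseq #|D| of D} |
        path_subdigraph [seq val p | p <- P])
    size (flatten [seq val p | p <- P]).

Section Induced.
Variables (D : digraph) (X : {set D}).

Definition induced_arc : rel {x : D | x \in X} :=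
  fun x y => arc (val x) (val y).

Fact induced_arc_irrefl : irreflexive induced_arc.
Proof. by move=> x; apply: arc_irrefl. Qed.

Definition induced : digraph := Digraph induced_arc_irrefl.
End Induced.

Definition dipartition (D : digraph) (X Y : {set D}) : Prop :=
  [disjoint X & Y] /\ X :|: Y = [set: D].

(* The last inequality is lambda_k B <= lambda_k D - q, written without
   truncated subtraction. *)
Definition BNY (D : digraph) : Prop :=
  forall q : nat, 1 <= q <= lambda D - 1 ->
  exists X Y : {set D},
    [/\ dipartition X Y,
        lambda (induced X) <= q
      & forall k : nat, 1 <= k <= #|induced Y| ->
          lambda_k (induced Y) k + q <= lambda_k D k].

Section Composition.
Variables (T : digraph) (H : T -> digraph).

(* When [tag v == tag u], [tagged_as u v] is the vertex of v cast to
   [H (tag u)]. *)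
Definition composition_arc : rel {i : T & H i} :=
  fun u v => arc (tag u) (tag v)
             || (tag u == tag v) && arc (tagged u) (tagged_as u v).

Fact composition_arc_irrefl : irreflexive composition_arc.
Proof.
by case=> i x; rewrite /composition_arc tagged_asE !arc_irrefl andbF.
Qed.

Definition composition : digraph := Digraph composition_arc_irrefl.
End Composition.

(* Main.v *)
From mathcomp Require Import all_boot.
Require Import Defs.

Set Implicit Arguments.
Unset Strict Implicit.
Unset Printing Implicit Defensive.

(** Call the copy of [H i] inside the composition the block of [i].  Every arc
    between two blocks follows an arc of the acyclic digraph [T], so a path
    never returns to a block that it has left: it is a concatenation of paths of
    the [H i], and two consecutive blocks are completely joined.  Hence a segment
    inside a block can be exchanged for any other path of that block.

    Let [entry i] be the largest order of a path that can be continued into every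
    vertex of the block of [i]; it increases strictly along the arcs of [T]
    ([entry_arc]).  Given [q], apply property BNY in each block with
    [q - entry i] in place of [q], where the extreme values 0 and at least
    [lambda (H i)] are trivially possible ([BNY_total]), and let [X] be the union
    of the first parts obtained in this way.

    A path inside [X] consists of a segment in its last block [i], of order at
    most [q - entry i], preceded by at most [entry i] vertices; this gives
    [lambda X <= q] ([lambda_lift_blocks]).

    Now let [P] be an optimal k-path subdigraph that avoids [X], and among the
    blocks met by [P] take the block of [i] with the smallest [entry i].  A path
    of [P] that meets this block starts there.  If [m] paths do so, their
    initial segments have at most [lambda_k (H i) m - (q - entry i)] vertices
    altogether; replacing them by an optimal m-path subdigraph of [H i] gains
    [q - entry i] vertices.  By minimality, a longest path entering the block of
    [i] lives in blocks that [P] does not meet, so it can be put in front of one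
    of these paths and gains another [entry i] vertices ([lambda_k_gain]).  The
    total gain is at least [q]. *)

(** * Sequences *)

Lemma map_preimage_in (S : Type) (R : eqType) (C : pred S) (f : S -> R) (s : seq R) :
  (forall y, y \in s -> exists2 x, C x & f x = y) ->
  exists2 t, all C t & map f t = s.
Proof.
elim: s => [|y s IHs] fs; first by exists [::].
have [x Cx <-] := fs y (mem_head y s).
have [|t Ct <-] := IHs; first by move=> z z_s; apply: fs; rewrite in_cons z_s orbT.
by exists (x :: t); rewrite //= Cx.
Qed.

Lemma map_preimage (S : Type) (R : eqType) (f : S -> R) (s : seq R) :
  (forall y, y \in s -> exists x, f x = y) -> exists t, map f t = s.
Proof.
move=> fs; have [|t _ <-] := @map_preimage_in _ _ predT f s; last by exists t.
by move=> y /fs[x <-]; exists x.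
Qed.

Lemma flatten_map_cat (A : Type) (V : eqType) (a b : A -> seq V) (Z : seq A) :
  perm_eq (flatten [seq a z ++ b z | z <- Z])
          (flatten (map a Z) ++ flatten (map b Z)).
Proof.
elim: Z => //= z Z IHZ.
by rewrite -!catA perm_cat2l perm_sym perm_catCA perm_cat2l perm_sym.
Qed.

Section LongestSequence.
Variables (V : finType) (C : pred (seq V)).

(** The sequences [p] of interest are duplicate-free, so the bound on their size
    loses none of them.  The maximum of the orders of paths is the case
    [C := @dipath D]. *)
Definition max_size := \max_(p : {bseq #|V| of V} | C p) size p.

Lemma size_uniq_card (p : seq V) : uniq p -> size p <= #|V|.
Proof. by move/card_uniqP=> <-; apply: max_card. Qed.

Lemma max_size_ge p : uniq p -> C p -> size p <= max_size.
Proof.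
by move=> /size_uniq_card le_p Cp; apply: (leq_bigmax_cond (Bseq le_p) Cp).
Qed.

Lemma max_size_attained p0 : uniq p0 -> C p0 -> exists2 p, C p & size p = max_size.
Proof.
move=> /size_uniq_card le_p0 Cp0.
have [|p Cp eq_p] := eq_bigmax_cond (I := {bseq #|V| of V})
  (A := fun b : {bseq #|V| of V} => C b) (fun b : {bseq #|V| of V} => size b).
  by apply/card_gt0P; exists (Bseq le_p0).
by exists p.
Qed.
End LongestSequence.

(** * Path orders of a digraph and of its induced subdigraphs *)

Section PathOrders.
Variable D : digraph.
Implicit Types (p : seq D) (P : seq (seq D)) (X Y : {set D}).

Lemma lambda_ge p : dipath p -> size p <= lambda D.
Proof. by move=> p_path; apply: max_size_ge => //; case/and3P: p_path. Qed.

Lemma lambda_le n : (forall p, dipath p -> size p <= n) -> lambda D <= n.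
Proof. by move=> le_n; apply/bigmax_leqP => p; apply: le_n. Qed.

Lemma lambda_k_ge P :
  path_subdigraph P -> size (flatten P) <= lambda_k D (size P).
Proof.
move=> P_sub.
have P_preim p : p \in P -> exists b : {bseq #|D| of D}, val b = p.
  case/andP: P_sub => /allP P_paths _ /P_paths/and3P[_ _ /size_uniq_card le_p].
  by exists (Bseq le_p).
have [B eqP] := map_preimage P_preim; rewrite -{}eqP size_map in P_sub *.
exact: (leq_bigmax_cond (in_tuple B)).
Qed.

Lemma lambda_k_attained k : k <= #|D| -> exists P : seq (seq D),
  [/\ path_subdigraph P, size P = k & size (flatten P) = lambda_k D k].
Proof.
move=> le_k.
(* The range of the maximum is nonempty: it contains [k] single vertices. *)
pose P1 := [seq [:: x] | x <- take k (enum D)].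
have P1_sub : path_subdigraph P1.
  rewrite /path_subdigraph; apply/andP; split; first by apply/allP=> _ /mapP[x _ ->].
  by rewrite flatten_map1 map_id take_uniq ?enum_uniq.
have P1_preim p : p \in P1 -> exists b : {bseq #|D| of D}, val b = p.
  case/mapP=> x _ ->; have le_x := @size_uniq_card D [:: x] isT.
  by exists (Bseq le_x).
have [B eqB] := map_preimage P1_preim.
have sB : size B == k.
  by rewrite -(size_map val B) eqB size_map size_takel // -cardE.
have [|Q Q_sub eqQ] := eq_bigmax_cond (I := k.-tuple {bseq #|D| of D})
  (A := fun Q : k.-tuple {bseq #|D| of D} => @path_subdigraph D (map val Q))
  (fun Q : k.-tuple {bseq #|D| of D} => size (flatten (map val Q))).
  by apply/card_gt0P; exists (Tuple sB); rewrite unfold_in /= eqB.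
by exists (map val Q); rewrite size_map size_tuple.
Qed.

End PathOrders.

(** Uniqueness of the vertices of each path follows from that of all the vertices
    together, so that surgery on paths need only keep track of the latter. *)
Lemma path_subdigraphE (D : digraph) (P : seq (seq D)) :
  path_subdigraph P
  = all [pred p | (p != [::]) && sorted arc p] P && uniq (flatten P).
Proof.
rewrite /path_subdigraph; apply: andb_id2r => P_uniq.
apply: eq_in_all => p pP; case/splitPr: pP P_uniq => P1 P2.
rewrite flatten_cat /= !cat_uniq => /and3P[_ _ /andP[p_uniq _]].
by rewrite /dipath p_uniq andbT.
Qed.

Lemma path_subdigraph_card (D : digraph) (Y : {set D}) (P : seq (seq D)) :
  path_subdigraph P -> {subset flatten P <= Y} -> size P <= #|Y|.
Proof.
rewrite path_subdigraphE => /andP[/allP P_paths P_uniq] PY.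
apply: (@leq_trans (size (flatten P))).
  rewrite size_flatten /shape; elim: P P_paths {P_uniq PY} => //= p P IHP P_paths.
  rewrite -add1n leq_add ?IHP //; last first.
    by move=> r rP; apply: P_paths; rewrite in_cons rP orbT.
  by have /andP[] := P_paths p (mem_head p P); case: p {P_paths}.
by rewrite -(card_uniqP P_uniq); apply: subset_leq_card; apply/subsetP.
Qed.

Section InducedPaths.
Variable D : digraph.
Implicit Types (p : seq D) (P : seq (seq D)) (X : {set D}).

Lemma dipath_induced X (p : seq (induced X)) : dipath (map val p) = dipath p.
Proof.
by rewrite /dipath sorted_map (map_inj_uniq val_inj); case: p.
Qed.

Lemma path_subdigraph_induced X (P : seq (seq (induced X))) :
  path_subdigraph (map (map val) P) = path_subdigraph P.
Proof.
rewrite /path_subdigraph -map_flatten (map_inj_uniq val_inj) all_map.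
by congr (_ && _); apply: eq_all => p; apply: dipath_induced.
Qed.

Lemma lift_induced X p : {subset p <= X} -> exists p' : seq (induced X), map val p' = p.
Proof. by move=> pX; apply: map_preimage => x /pX x_X; exists (Sub x x_X). Qed.

Lemma lambda_induced_ge X p :
  dipath p -> {subset p <= X} -> size p <= lambda (induced X).
Proof.
move=> p_path /lift_induced[p' eq_p]; rewrite -{}eq_p dipath_induced in p_path *.
by rewrite size_map; apply: lambda_ge.
Qed.

Lemma lambda_k_induced_ge X P : path_subdigraph P -> {subset flatten P <= X} ->
  size (flatten P) <= lambda_k (induced X) (size P).
Proof.
move=> P_sub PX.
have [p pP|P' eqP] := @map_preimage _ _ (map val : seq (induced X) -> seq D) P.
  by apply: lift_induced => x xp; apply/PX/flattenP; exists p.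
rewrite -{}eqP path_subdigraph_induced in P_sub *.
by rewrite -map_flatten !size_map; apply: lambda_k_ge.
Qed.

Lemma lambda_k_induced_attained X k : k <= #|induced X| -> exists P : seq (seq D),
  [/\ path_subdigraph P, size P = k, {subset flatten P <= X}
    & size (flatten P) = lambda_k (induced X) k].
Proof.
case/lambda_k_attained=> P [P_sub <- <-]; exists (map (map val) P).
rewrite path_subdigraph_induced -map_flatten !size_map; split=> //.
by move=> _ /mapP[x _ ->]; apply: valP.
Qed.

Lemma card_induced X : #|induced X| = #|X|.
Proof. exact: card_sig. Qed.

(** For [g = 0] take [X] empty, and for [g >= lambda D] take [X] to be everything,
    which leaves no [k] to consider.  A composition needs these extreme values
    in the blocks that a partition does not split. *)
Lemma BNY_total : BNY D -> forall g, exists X : {set D},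
  lambda (induced X) <= g /\
  forall k, 1 <= k <= #|~: X| -> lambda_k (induced (~: X)) k + g <= lambda_k D k.
Proof.
move=> D_BNY [|g].
  exists set0; split=> [|k /andP[_ le_k]].
    by apply: lambda_le => -[|x p] //; have := valP x; rewrite inE.
  rewrite -card_induced in le_k.
  have [P [P_sub <- _ <-]] := lambda_k_induced_attained le_k.
  by rewrite addn0 lambda_k_ge.
have [le_g|lt_g] := leqP (lambda D) g.+1.
  exists setT; split=> [|k].
    apply: lambda_le => p; rewrite -dipath_induced -(size_map val).
    by move/lambda_ge/leq_trans; apply.
  by rewrite setCT cards0; case: k.
have [|X [Y [[disj cover] leX leY]]] := D_BNY g.+1.
  by rewrite /= leq_subRL ?(leq_trans _ lt_g).
have eqY : Y = ~: X.
  apply/setP=> x; have := in_setT x; rewrite -cover !inE.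
  by case xX: (x \in X) => //= _; rewrite (disjointFr disj xX).
by exists X; split=> // k; rewrite -eqY -card_induced; apply: leY.
Qed.
End InducedPaths.

(** * Acyclic digraphs *)

(** The rank of [i] is the largest order of a path that can be continued to [i].
    Such a path does not contain [i], since otherwise it would close a cycle. *)
Lemma acyclic_rank (T : digraph) : acyclic T ->
  exists rk : T -> nat, forall i j, arc i j -> rk i < rk j.
Proof.
move=> T_acyclic.
pose C i := [pred p : seq T | uniq p && sorted arc (rcons p i)].
exists (fun i => max_size (C i)) => i j arc_ij.
have [//|//|p /andP[p_uniq p_sorted] <-] := @max_size_attained _ (C i) [::].
have ip : i \notin p.
  apply/negP=> /splitPr def_p; case: def_p p_sorted p_uniq => p1 p2.
  rewrite rcons_cat rcons_cons sorted_cat_cons cat_uniq => /andP[_ cyc] /and3P[_ _ uq].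
  apply: T_acyclic; exists (i :: p2); apply/and3P; split=> //.
  by case: p2 cyc {uq} => //=; rewrite arc_irrefl.
rewrite -(size_rcons p i) max_size_ge //= rcons_uniq ip // p_uniq /=.
by rewrite -cats1 cat_rcons sorted_cat_cons p_sorted /= arc_ij.
Qed.

(** * Paths in a composition *)

Section Composition.
Variables (T : digraph) (H : T -> digraph).
Hypothesis H_nonempty : forall i : T, 0 < #|H i|.
Local Notation Q := (composition H).
Implicit Types (i j : T) (u v : Q) (p s : seq Q) (P : seq (seq Q)).

Definition in_block i (x : H i) : Q := Tagged (fun i => H i : Type) x.

Lemma in_block_inj i : injective (@in_block i).
Proof. by move=> x y /eqP; rewrite /in_block eq_Tagged => /eqP. Qed.

Lemma arc_in_block i (x y : H i) : arc (in_block x) (in_block y) = arc x y.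
Proof.
by rewrite /= /composition_arc /= arc_irrefl eqxx /= tagged_asE.
Qed.

Lemma arc_across u v : arc (tag u) (tag v) -> arc u v.
Proof. by move=> uv; rewrite /= /composition_arc uv. Qed.

Lemma arc_tag u v : arc u v -> arc (tag u) (tag v) \/ tag u = tag v.
Proof.
by case/orP=> [|/andP[/eqP eq_tag _]]; [left | right].
Qed.

(** Distinct blocks are joined completely or not at all, hence the quantification
    over all the vertices of the block.  As there are no loops, it forces the
    last vertex of a nonempty [p], respectively the first vertex of a nonempty
    [s], to lie outside the block ([enters_potential], [leaves_potential]). *)
Definition enters i p := [forall x : H i, sorted arc (rcons p (in_block x))].
Definition leaves i s := [forall x : H i, path arc (in_block x) s].

(** The exchange property: what comes before and after a segment inside a block does
    not depend on the segment. *)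
Lemma sorted_through_block i p (r : seq (H i)) s :
  enters i p -> r != [::] -> sorted arc r -> leaves i s ->
  sorted arc (p ++ map (@in_block i) r ++ s).
Proof.
case: r => // x r /forallP/(_ x) p_x _ /= r_path /forallP/(_ (last x r)) s_path.
rewrite sorted_cat_cons p_x cat_path last_map s_path andbT /=.
by apply: (homo_path (e' := @arc Q)) r_path => y z; rewrite arc_in_block.
Qed.

Lemma path_last_block p : p != [::] -> sorted arc p ->
  exists i (r : seq (H i)) p1,
    [/\ p = p1 ++ map (@in_block i) r, r != [::], sorted arc r & enters i p1].
Proof.
elim/last_ind: p => // p u IHp _.
have [-> _|p_n0] := eqVneq p [::].
  exists (tag u), [:: tagged u], [::]; split=> //; first by case: u.
  by apply/forallP.
move=> pu_sorted.
have p_sorted : sorted arc p.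
  by case: (p) pu_sorted => //= x p'; rewrite rcons_path => /andP[].
have [i [r [p1 [def_p r_n0 r_sorted p1_enters]]]] := IHp p_n0 p_sorted.
case/lastP: r => // r z in def_p r_n0 r_sorted.
have arc_zu : arc (in_block z) u.
  move: pu_sorted; rewrite def_p map_rcons -rcons_cat -[rcons _ u]cats1 cat_rcons.
  by rewrite sorted_cat_cons /= andbT => /andP[].
have [across|eq_i] := arc_tag arc_zu.
  exists (tag u), [:: tagged u], p; split=> //; first by rewrite cats1; case: (u).
  apply/forallP=> x; move: p_sorted; rewrite def_p map_rcons -rcons_cat.
  rewrite -[rcons (rcons _ _) _]cats1 cat_rcons sorted_cat_cons => -> /=.
  by rewrite andbT; apply: arc_across.
case: u eq_i arc_zu {pu_sorted} => j y /= eq_i; move: y; case: j / eq_i => y arc_zy.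
exists i, (rcons (rcons r z) y), p1; split=> //; first by rewrite def_p !map_rcons !rcons_cat.
  by case: (r).
rewrite -cats1 cat_rcons sorted_cat_cons r_sorted /= andbT.
by rewrite -arc_in_block; apply: arc_zy.
Qed.

Lemma path_first_block p : p != [::] -> sorted arc p ->
  exists i (r : seq (H i)) s,
    [/\ p = map (@in_block i) r ++ s, r != [::], sorted arc r & leaves i s].
Proof.
elim: p => // u p IHp _ up_path.
have [->|p_n0] := eqVneq p [::].
  exists (tag u), [:: tagged u], [::]; split=> //; first by case: u {up_path}.
  by apply/forallP.
have p_sorted : sorted arc p by apply: path_sorted up_path.
have [i [r [s [def_p r_n0 r_sorted s_leaves]]]] := IHp p_n0 p_sorted.
case: r => // z r in def_p r_n0 r_sorted.
have arc_uz : arc u (in_block z) by move: up_path; rewrite def_p => /andP[].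
have [across|eq_i] := arc_tag arc_uz.
  exists (tag u), [:: tagged u], p; split=> //; first by case: (u).
  apply/forallP=> x; rewrite def_p /= in p_sorted *; rewrite p_sorted andbT.
  exact: arc_across.
case: u eq_i arc_uz {up_path} => j y /= /esym eq_i; move: y; case: j / eq_i => y arc_yz.
exists i, (y :: z :: r), s; split=> //; first by rewrite def_p.
by rewrite /= -arc_in_block [arc _ _]arc_yz.
Qed.

(** * Gaining vertices in the first block *)

Section Potential.
(* This is used twice: first with the rank of [T], in order to show that [entry]
   is itself such a function, and then with [entry]. *)
Variable f : T -> nat.
Hypothesis f_arc : forall i j, arc i j -> f i < f j.

Lemma path_potential u s v :
  path arc u s -> v \in u :: s -> f (tag u) <= f (tag v).
Proof.
move=> us; rewrite in_cons => /predU1P[-> //|vs].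
have f_le : {homo (fun w : Q => f (tag w)) : w w' / arc w w' >-> w <= w'}.
  by move=> w w' /arc_tag[/f_arc/ltnW|->].
have := order_path_min leq_trans (homo_path f_le us).
by move/allP; apply; apply: map_f.
Qed.

Lemma enters_potential i p u : enters i p -> u \in p -> f (tag u) < f i.
Proof.
case/lastP: p => // p v /forallP p_enters u_p.
have /card_gt0P[x0 _] := H_nonempty i.
have arc_v (x : H i) : arc v (in_block x).
  by have := p_enters x; rewrite -cats1 cat_rcons sorted_cat_cons /= andbT => /andP[].
have lt_v : f (tag v) < f i.
  have [/f_arc //|eq_i] := arc_tag (arc_v x0).
  case: v eq_i arc_v {p_enters u_p} => j y /= /esym eq_i; move: y; case: j / eq_i => y.
  by move/(_ y) => loop; case/negP: (negbT (arc_irrefl (in_block y))).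
apply: leq_ltn_trans lt_v.
have := p_enters x0; case/splitPr def_p: _ / u_p => [p1 p2].
rewrite rcons_cat rcons_cons sorted_cat_cons rcons_path => /and3P[_ p2_path _].
apply: path_potential p2_path _.
have -> : v = last u p2 by rewrite -(last_rcons u p v) def_p last_cat.
exact: mem_last.
Qed.

Lemma leaves_potential i s v : leaves i s -> v \in s -> f i < f (tag v).
Proof.
case: s => // u s /forallP s_leaves v_s.
have /card_gt0P[x0 _] := H_nonempty i.
have arc_u (x : H i) : arc (in_block x) u by have /andP[] := s_leaves x.
have lt_u : f i < f (tag u).
  have [/f_arc //|/= eq_i] := arc_tag (arc_u x0).
  case: u eq_i arc_u {s_leaves v_s} => j y /= eq_i; move: y; case: j / eq_i => y.
  by move/(_ y) => loop; case/negP: (negbT (arc_irrefl (in_block y))).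
apply: leq_trans lt_u _; have /andP[_ us_path] := s_leaves x0.
exact: path_potential us_path v_s.
Qed.

(** The potential increases strictly whenever a path leaves a block, so a block of
    minimal potential can only be the first one on the path. *)
Lemma path_minimal_block i p u : sorted arc p -> u \in p -> tag u = i ->
    {in p, forall v, f i <= f (tag v)} ->
  exists (r : seq (H i)) s,
    [/\ p = map (@in_block i) r ++ s, r != [::], sorted arc r & leaves i s].
Proof.
move=> p_sorted u_p tag_u p_min.
have p_n0 : p != [::] by case: (p) u_p.
have [j [r [s [def_p r_n0 r_sorted s_leaves]]]] := path_first_block p_n0 p_sorted.
suff eq_ij : j = i by case: i / eq_ij {tag_u p_min}; exists r, s.
move: u_p; rewrite def_p mem_cat => /orP[/mapP[x _ def_u]|u_s].
  by rewrite -tag_u def_u.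
have := leaves_potential s_leaves u_s; rewrite tag_u ltnNge.
case: r r_n0 def_p {r_sorted} => // x r _ def_p.
by rewrite (p_min (in_block x)) // def_p mem_head.
Qed.

(** The paths of [P] that meet the block of [i] begin with segments inside it.  These
    segments are exchanged for an optimal path subdigraph of [H i] with the same
    number of paths, and one of the resulting paths is extended backwards by
    [p0].  The rest of [P] lies outside the block and at potential at least
    [f i], whereas [p0] lies at potential less than [f i]; therefore the new
    paths are disjoint. *)
Lemma lambda_k_gain i g p0 P :
    path_subdigraph P -> (exists2 u, u \in flatten P & tag u = i) ->
    {in flatten P, forall v, f i <= f (tag v)} ->
    uniq p0 -> enters i p0 ->
    (forall R : seq (seq (H i)), path_subdigraph R -> 0 < size R ->
      {subset map (@in_block i) (flatten R) <= flatten P} ->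
      size (flatten R) + g <= lambda_k (H i) (size R)) ->
  size p0 + (size (flatten P) + g) <= lambda_k Q (size P).
Proof.
set F := flatten P => P_sub [u uF tag_u] F_min p0_uniq p0_enters gain.
have /andP[/allP P_paths F_uniq] : all [pred p | (p != [::]) && sorted arc p] P && uniq F.
  by rewrite -path_subdigraphE.
pose meets := has (fun v : Q => tag v == i).
pose P1 := filter meets P; pose P2 := filter (predC meets) P.
have perm_P : perm_eq (P1 ++ P2) P by rewrite perm_filterC.
have perm_F : perm_eq (flatten P1 ++ flatten P2) F.
  by rewrite -flatten_cat perm_flatten.
(* A pair [z] is a path meeting the block, cut where it leaves the block. *)
pose glue (z : seq (H i) * seq Q) := map (@in_block i) z.1 ++ z.2.
pose glueable (z : seq (H i) * seq Q) :=
  [&& z.1 != [::], sorted arc z.1 & leaves i z.2].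
have [p|Z /allP Z_glueable def_P1] := @map_preimage_in _ _ glueable glue P1.
  rewrite mem_filter => /andP[/hasP[v vp /eqP tag_v] pP].
  have /andP[_ p_sorted] := P_paths p pP.
  have [|r [s [def_p r_n0 r_sorted s_leaves]]] := path_minimal_block p_sorted vp tag_v.
    by move=> w wp; apply: F_min; apply/flattenP; exists p.
  by exists (r, s); [apply/and3P | rewrite def_p].
pose R := unzip1 Z; pose S := unzip2 Z.
have flatten_glue W : perm_eq (flatten (map glue W))
    (map (@in_block i) (flatten (unzip1 W)) ++ flatten (unzip2 W)).
  by rewrite map_flatten -map_comp; apply: flatten_map_cat.
have perm_F' : perm_eq (map (@in_block i) (flatten R) ++ flatten S ++ flatten P2) F.
  rewrite catA; apply: perm_trans perm_F; rewrite perm_cat2r perm_sym -def_P1.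
  exact: flatten_glue.
have R_sub : path_subdigraph R.
  rewrite path_subdigraphE; apply/andP; split.
    by apply/allP=> _ /mapP[z /Z_glueable/and3P[z_n0 z_sorted _] ->]; apply/andP.
  apply: (@map_uniq _ _ (@in_block i)).
  by move: F_uniq; rewrite -(perm_uniq perm_F') cat_uniq => /andP[].
have sz_R : size R = size P1 by rewrite -def_P1 !size_map.
have R_gt0 : 0 < size R.
  rewrite sz_R size_filter -has_count; apply/hasP.
  have [p pP up] := flattenP uF; exists p => //; apply/hasP; exists u => //.
  exact/eqP.
have {}gain : size (flatten R) + g <= lambda_k (H i) (size R).
  apply: gain => // v vR; rewrite -(perm_mem perm_F') mem_cat.
  by rewrite vR.
have le_R : size R <= #|H i|.
  by rewrite -cardsT; apply: path_subdigraph_card R_sub _ => x; rewrite inE.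
(* [R'] replaces the initial segments [R]; any matching with the tails [S] works. *)
have [R' [R'_sub sz_R' opt_R']] := lambda_k_attained le_R.
move: R'_sub; rewrite path_subdigraphE => /andP[/allP R'_paths R'_uniq].
pose Z' := zip R' S.
have sz_S : size R' = size S by rewrite sz_R' !size_map.
have Z'_R : unzip1 Z' = R' by rewrite unzip1_zip ?sz_S.
have Z'_S : unzip2 Z' = S by rewrite unzip2_zip ?sz_S.
have Z'_glueable z : z \in Z' -> glueable z.
  move=> zZ'; have z1 : z.1 \in R' by rewrite -Z'_R map_f.
  have /mapP[w wZ eq_z2] : z.2 \in S by rewrite -Z'_S map_f.
  have /andP[z_n0 z_sorted] := R'_paths _ z1.
  by have /and3P[_ _ w_leaves] := Z_glueable w wZ; apply/and3P; rewrite eq_z2.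
have sz_Z' : size Z' = size P1 by rewrite -sz_R -sz_R' -Z'_R size_map.
have perm_Z' := flatten_glue Z'; rewrite Z'_R Z'_S in perm_Z'.
have p0_sorted z : z \in Z' -> sorted arc (p0 ++ glue z).
  by move/Z'_glueable/and3P=> [z_n0 z_sorted z_leaves]; apply: sorted_through_block.
have glue_path z : z \in Z' -> (glue z != [::]) && sorted arc (glue z).
  move/Z'_glueable/and3P=> [z_n0 z_sorted z_leaves]; apply/andP; split.
    by rewrite /glue; case: (z.1) z_n0.
  by apply: (@sorted_through_block i [::]) => //; apply/forallP.
case def_Z': Z' => [|z0 Z0] in sz_Z' p0_sorted glue_path perm_Z' *.
  by rewrite -sz_Z' in sz_R; rewrite sz_R in R_gt0.
pose P' := (p0 ++ glue z0) :: map glue Z0 ++ P2.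
have perm_P' : perm_eq (flatten P')
    (p0 ++ map (@in_block i) (flatten R') ++ flatten S ++ flatten P2).
  rewrite /= flatten_cat -catA perm_cat2l !catA perm_cat2r.
  exact: perm_Z'.
have sz_P' : size P' = size P.
  by rewrite -(perm_size perm_P) size_cat -sz_Z' /= size_cat size_map.
rewrite -sz_P'; apply: leq_trans (lambda_k_ge _).
  rewrite (perm_size perm_P') size_cat leq_add2l -(perm_size perm_F') !size_cat !size_map.
  by rewrite addnAC leq_add2r opt_R'.
rewrite path_subdigraphE; apply/andP; split.
  apply/allP=> p; rewrite in_cons mem_cat => /or3P[/eqP-> | /mapP[z zZ0 ->] | ].
  - rewrite inE p0_sorted ?mem_head // andbT.
    have /andP[] := glue_path z0 (mem_head z0 Z0).
    by case: (glue z0) => // v s _ _; case: (p0).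
  - by rewrite inE glue_path // in_cons zZ0 orbT.
  by rewrite mem_filter => /andP[_ /P_paths].
(* It remains to see that the new paths are disjoint. *)
have S_leave v : v \in flatten S -> f i < f (tag v).
  case/flattenP=> _ /mapP[z /Z_glueable/and3P[_ _ z_leaves] ->].
  exact: leaves_potential z_leaves.
have tails_i v : v \in flatten S ++ flatten P2 -> tag v != i /\ f i <= f (tag v).
  rewrite mem_cat => /orP[/S_leave lt_v|vP2].
    by split; [apply: contraTneq lt_v => ->; rewrite ltnn | apply: ltnW].
  split; last by apply: F_min; rewrite -(perm_mem perm_F) mem_cat vP2 orbT.
  case/flattenP: vP2 => p; rewrite mem_filter => /andP[/hasPn p_avoids _].
  exact: p_avoids.
rewrite (perm_uniq perm_P') !(cat_uniq p0, cat_uniq (map _ _)) p0_uniq.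
rewrite (map_inj_uniq (@in_block_inj i)) R'_uniq.
move: F_uniq; rewrite -(perm_uniq perm_F') cat_uniq => /and3P[_ _ ->].
rewrite andbT /=; apply/andP; split; apply/hasPn => v.
  rewrite mem_cat => v_new; apply/negP=> /(enters_potential p0_enters).
  case/orP: v_new => [/mapP[x _ ->]|/tails_i[_ le_v]]; first by rewrite ltnn.
  by rewrite ltnNge le_v.
by case/tails_i=> tag_v _; apply: contraNN tag_v => /mapP[x _ ->].
Qed.
End Potential.

(** * The partition of a composition *)

Hypothesis T_acyclic : acyclic T.

Definition entry i := max_size (fun p => uniq p && enters i p).

Lemma entry_ge i p : uniq p -> enters i p -> size p <= entry i.
Proof. by move=> p_uniq p_enters; apply: max_size_ge; rewrite ?p_uniq. Qed.

Lemma entry_attained i :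
  exists p, [/\ uniq p, enters i p & size p = entry i].
Proof.
have nil_enters : enters i [::] by apply/forallP.
have [//|//|p /andP[p_uniq p_enters] eq_p] :=
  @max_size_attained Q (fun p => uniq p && enters i p) [::].
by exists p.
Qed.

(** A longest path entering the block of [i] can be lengthened by a vertex of that
    block, which is new because the path runs through blocks of lower rank. *)
Lemma entry_arc i j : arc i j -> entry i < entry j.
Proof.
move=> arc_ij; have [rk rk_arc] := acyclic_rank T_acyclic.
have [p [p_uniq p_enters <-]] := entry_attained i.
have /card_gt0P[x _] := H_nonempty i.
rewrite -(size_rcons p (in_block x)); apply: entry_ge.
  rewrite rcons_uniq p_uniq andbT; apply/negP=> /(enters_potential rk_arc p_enters).
  by rewrite ltnn.
apply/forallP=> y; rewrite -cats1 cat_rcons sorted_cat_cons (forallP p_enters) /= andbT.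
exact: arc_across.
Qed.

Definition lift_blocks (X : forall i, {set H i}) : {set Q} :=
  [set u | tagged u \in X (tag u)].

Lemma lambda_lift_blocks q (X : forall i, {set H i}) :
    (forall i, lambda (induced (X i)) <= q - entry i) ->
  lambda (induced (lift_blocks X)) <= q.
Proof.
move=> X_le; apply: lambda_le => p'; rewrite -dipath_induced -(size_map val).
have pX : {subset map val p' <= lift_blocks X} by move=> _ /mapP[u _ ->]; apply: valP.
move: (map val p') pX => p pX /and3P[p_n0 p_sorted p_uniq].
have [i [r [p1 [def_p r_n0 r_sorted p1_enters]]]] := path_last_block p_n0 p_sorted.
move: p_uniq; rewrite def_p cat_uniq => /and3P[p1_uniq _].
rewrite (map_inj_uniq (@in_block_inj i)) => r_uniq.
have le_r : size r <= q - entry i.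
  apply: leq_trans (X_le i); apply: lambda_induced_ge; first exact/and3P.
  move=> x xr; have := pX (in_block x); rewrite inE; apply.
  by rewrite def_p mem_cat map_f ?orbT.
(* As [r] is nonempty, the subtraction is not truncated. *)
have lt_entry : entry i < q.
  by rewrite -subn_gt0; apply: leq_trans le_r; case: (r) r_n0.
by rewrite size_cat size_map -(subnKC (ltnW lt_entry)) leq_add ?entry_ge.
Qed.

Lemma lambda_k_lift_blocks q (X : forall i, {set H i}) k :
    (forall i m, 1 <= m <= #|~: X i| ->
      lambda_k (induced (~: X i)) m + (q - entry i) <= lambda_k (H i) m) ->
    1 <= k <= #|induced (~: lift_blocks X)| ->
  lambda_k (induced (~: lift_blocks X)) k + q <= lambda_k Q k.
Proof.
move=> X_gain /andP[k_gt0 /lambda_k_induced_attained[P [P_sub def_k PX <-]]].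
have [u0 u0P] : exists u, u \in flatten P.
  move: P_sub; rewrite path_subdigraphE -def_k in k_gt0 *.
  by case: (P) k_gt0 => // -[//|u p] P' _ _; exists u; exact: mem_head.
case: (arg_minnP (P := mem (flatten P)) (fun u : Q => entry (tag u)) u0P) => u uP u_min.
have [p0 [p0_uniq p0_enters sz_p0]] := entry_attained (tag u).
have gain := @lambda_k_gain entry entry_arc (tag u) (q - entry (tag u)) p0 P.
rewrite -def_k; apply: leq_trans (gain _ _ _ _ _ _) => //.
- by rewrite addnCA leq_add2l sz_p0 -leq_subLR.
- by exists u.
move=> R R_sub R_gt0 RP.
have RX : {subset flatten R <= ~: X (tag u)}.
  by move=> x /(map_f (@in_block (tag u)))/RP/PX; rewrite !inE.
apply: leq_trans (X_gain (tag u) _ _).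
  by rewrite leq_add2r; apply: lambda_k_induced_ge.
by rewrite R_gt0; apply: path_subdigraph_card.
Qed.
End Composition.

Theorem theorem3 (T : digraph) (H : T -> digraph)
    (T_acyclic : acyclic T)
    (H_nonempty : forall i : T, 0 < #|H i|)
    (H_BNY : forall i : T, BNY (H i)) :
  BNY (composition H).
Proof.
move=> q _.
have /fin_all_exists[X X_BNY] i := BNY_total (H_BNY i) (q - entry H i).
exists (lift_blocks X), (~: lift_blocks X); split.
- by split; [rewrite -setI_eq0 setICr | rewrite setUCr].
- by apply: lambda_lift_blocks => // i; case: (X_BNY i).
by move=> k; apply: lambda_k_lift_blocks => // i; case: (X_BNY i).
Qed.
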